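(* Let $(r_n)_{n\ge 1}$ and $(R_i)_{i \ge 1}$ be sequences of real numbers, set $r_0 := 0$ and $R_0 := 0$, and assume that the sequences are related by $$R_i = \sum_{k \geq 0} r_{\lfloor i/2^k \rfloor} \quad \text{for all } i \geq 1$$ (a finite sum since $r_0=0$), or equivalently by $r_n = R_n - R_{\lfloor n/2 \rfloor}$ for all $n \geq 1$. Then the series $\sum_{n\ge 1} |r_n| n^{-2}$ converges if and only if the series $\sum_{i \ge 1} |R_i| i^{-2}$ converges, and in this case $$\sum_{n \geq 1} r_n \left(\frac{1}{n} - \log \frac{n+1}{n}\right) = \sum_{i \geq 1} \frac{R_i}{2i(2i+1)}.$$ *)

(* Defs.v *)
From mathcomp Require Export all_boot all_order all_algebra.
From mathcomp Require Export all_classical all_reals all_analysis.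

Export Order.TTheory GRing.Theory Num.Theory.
Export numFieldNormedType.Exports.

Set Implicit Arguments.
Unset Strict Implicit.
Unset Printing Implicit Defensive.

Local Open Scope ring_scope.

(* Analogue of [series] for sums over n >= 1: the sequence of partial sums
   u 1 + ... + u (N - 1).  As [limn] returns a value even for divergent
   sequences, a value [limn (series1 u)] is only meaningful together with
   [cvgn (series1 u)]. *)
Definition series1 (R : realType) (u : nat -> R) : nat -> R :=
  fun N => \sum_(1 <= n < N) u n.

(* Main.v *)
(* Write [a n = 1/n - ln ((n+1)/n)].  Since the logarithms telescope,
   [a n - a (2n) - a (2n+1) = 1 / (2n (2n+1))].  Substituting
   [r n = Rs n - Rs (n / 2)] into the partial sum of [r n * a n] over [n < 2N]
   therefore gives the partial sum of [Rs n / (2n (2n+1))] over [n < N] plus the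
   block sum of [Rs n * a n] over [N <= n < 2N], which tends to 0 because
   [0 <= a n <= 1 / n^2].
   For the convergence criterion, the weight [1 / n^2] makes the operator
   [f |-> (n |-> f (n / 2))] a contraction by a factor 1/2 on summable
   sequences, so that [Rs |-> r] is bounded with bounded inverse. *)
Require Import Defs.
From mathcomp Require Import ring lra.

Local Open Scope classical_set_scope.
Local Open Scope ring_scope.

Lemma series1E (R : realType) (u : nat -> R) :
  u 0%N = 0 -> series1 u = series u.
Proof.
move=> u0; apply/funext => -[|N]; rewrite /series1 /series /=.
  by rewrite !big_geq.
by rewrite [RHS]big_ltn // u0 add0r.
Qed.

Lemma series_double (V : zmodType) (u : nat -> V) (N : nat) :
  series u N.*2 = series (fun m => u m.*2 + u m.*2.+1) N.
Proof.
elim: N => [|N IH]; first by rewrite /series /= !big_geq.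
by rewrite doubleS !seriesSr IH addrA.
Qed.

Lemma cvg_double : N.*2 @[N --> \oo] --> \oo.
Proof.
rewrite (_ : double = muln 2); first exact: cvg_mulnl.
by apply/funext => N; rewrite mul2n.
Qed.

(** The partial sums increase and [N <= N.*2], so bounds at even indices suffice; at those indices
    halving pairs the terms exactly. *)
Lemma cvgn_series_double_bound (R : realType) (u : nat -> R) :
  (forall n, 0 <= u n) ->
  cvgn (series u) <-> exists C, forall N, series u N.*2 <= C.
Proof.
move=> u_ge0; have mono : {homo series u : n m / (n <= m)%N >-> n <= m}.
  by apply: nondecreasing_series => n _ _; exact: u_ge0.
split=> [cu | [C uC]].
  by exists (limn (series u)) => N; exact: nondecreasing_cvgn_le.
apply: nondecreasing_is_cvgn => //; exists C => _ [N _ <-].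
by apply: le_trans (uC N); apply: mono; rewrite -addnn leq_addr.
Qed.

Section DyadicSummability.
Variables (R : realType) (r Rs : nat -> R).
Hypothesis Rs0 : Rs 0%N = 0.
Hypothesis diff_rel : forall n : nat, r n = Rs n - Rs n./2.

Let weighted (f : nat -> R) (n : nat) : R := `|f n| / n%:R ^+ 2.

Let weighted_ge0 f n : 0 <= weighted f n.
Proof. by rewrite divr_ge0 // exprn_ge0. Qed.

(** Exactly [2m] and [2m+1] halve to [m], and for [m > 0] their weights satisfy [1/(2m)^2 +
    1/(2m+1)^2 <= 2/(2m)^2 = (1/2) (1/m^2)]. The pair at [m = 0] vanishes because [Rs 0 = 0]. *)
Lemma series_weighted_half (N : nat) :
  series (weighted (fun n => Rs n./2)) N.*2 <= series (weighted Rs) N / 2.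
Proof.
rewrite series_double /series /= mulr_suml; apply: ler_sum => -[|m] _.
  by rewrite /weighted /= Rs0 normr0 !mul0r addr0.
rewrite /weighted /= !doubleK uphalf_double -mulrDr -mulrA.
apply: ler_wpM2l => //.
have m_gt0 : 0 < m.+1%:R :> R by rewrite ltr0n.
have -> : (m.+1.*2)%:R = 2 * m.+1%:R :> R by rewrite -mul2n natrM.
have -> : (m.+1.*2.+1)%:R = 2 * m.+1%:R + 1 :> R.
  by rewrite -addn1 -mul2n natrD natrM.
move: (m.+1%:R) m_gt0 => x x_gt0.
have le_inv : ((2 * x + 1) ^+ 2)^-1 <= ((2 * x) ^+ 2)^-1.
  by rewrite lef_pV2 ?posrE ?exprn_gt0 //; nra.
have -> : (x ^+ 2)^-1 / 2 = ((2 * x) ^+ 2)^-1 + ((2 * x) ^+ 2)^-1.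
  by field; lra.
by rewrite lerD2l.
Qed.

Lemma cvgn_weighted_iff :
  cvgn (series (weighted r)) <-> cvgn (series (weighted Rs)).
Proof.
have le_series u v w N : (forall n, u n <= v n + w n) ->
    series u N <= series v N + series w N :> R.
  by move=> uvw; rewrite /series /= -big_split /=; apply: ler_sum.
have mono N : series (weighted Rs) N <= series (weighted Rs) N.*2.
  apply: nondecreasing_series; first by move=> n _ _; exact: weighted_ge0.
  by rewrite -addnn leq_addr.
rewrite !cvgn_series_double_bound; [split=> -[C HC]| exact: weighted_ge0 ..].
(* With [S] the weighted partial sums of [Rs], the triangle inequality gives
   [S(2N) <= C + S(N)/2 <= C + S(2N)/2], hence [S(2N) <= 2C]. *)
- exists (2 * C) => N; have monoN := mono N.
  have : series (weighted Rs) N.*2 <= series (weighted r) N.*2 +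
      series (weighted (fun n => Rs n./2)) N.*2.
    apply: le_series => n; rewrite /weighted -mulrDl.
    rewrite ler_wpM2r ?invr_ge0 ?exprn_ge0 //.
    by rewrite -[X in `|X| <= _](subrK (Rs n./2)) -diff_rel ler_normD.
  have := HC N; have := series_weighted_half N; lra.
- exists (C + C / 2) => N; have monoN := mono N.
  have : series (weighted r) N.*2 <= series (weighted Rs) N.*2 +
      series (weighted (fun n => Rs n./2)) N.*2.
    apply: le_series => n; rewrite /weighted -mulrDl.
    rewrite ler_wpM2r ?invr_ge0 ?exprn_ge0 //.
    by rewrite diff_rel ler_normB.
  have := HC N; have := series_weighted_half N; lra.
Qed.

(** The coefficient [c] is kept general to cover both [log_gap] and [1/(2i(2i+1))]. *)
Lemma cvgn_series_weighted (f c : nat -> R) :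
  (forall n, `|c n| <= (n%:R ^+ 2)^-1) ->
  cvgn (series (weighted f)) -> cvgn (series (fun n => f n * c n)).
Proof.
move=> c_le cf; apply: normed_cvg.
apply: series_le_cvg cf => [n|n|n]; [exact: normr_ge0|exact: weighted_ge0|].
by rewrite /= normrM ler_wpM2l.
Qed.

End DyadicSummability.

Section LogGap.
Variable R : realType.

Definition log_gap (n : nat) : R := n%:R^-1 - ln (n.+1%:R / n%:R).

Lemma normr_log_gap_le (n : nat) : `|log_gap n| <= (n%:R ^+ 2)^-1.
Proof.
case: n => [|n].
  (* At [n = 0] both sides are 0, by the default values of the inverse and of [ln] at 0. *)
  by rewrite /log_gap invr0 mulr0 ln0 // subrr normr0 expr0n invr0.
rewrite /log_gap -[n.+2]addn1 natrD.
have : 0 < n.+1%:R :> R by rewrite ltr0n.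
move: (n.+1%:R) => x x_gt0.
have x1_gt0 : 0 < x + 1 by lra.
have xV_gt0 : 0 < x^-1 by rewrite invr_gt0.
have x1V_gt0 : 0 < (x + 1)^-1 by rewrite invr_gt0.
have upper : ln ((x + 1) / x) <= x^-1.
  have -> : (x + 1) / x = 1 + x^-1 by field; lra.
  by apply: le_ln1Dx; lra.
(* This is [ln (1 + y) <= y] at [y = -1/(x+1)], after inverting the argument of the logarithm. *)
have lower : (x + 1)^-1 <= ln ((x + 1) / x).
  have -> : (x + 1) / x = (1 + - (x + 1)^-1)^-1 by field; lra.
  have x1V_lt1 : (x + 1)^-1 < 1 by rewrite invf_lt1 //; lra.
  rewrite lnV ?posrE; last by lra.
  by have := @le_ln1Dx R (- (x + 1)^-1); lra.
rewrite ger0_norm ?subr_ge0 //.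
have : x^-1 - (x + 1)^-1 <= (x ^+ 2)^-1.
  have -> : x^-1 - (x + 1)^-1 = x^-1 * (x + 1)^-1 by field; lra.
  rewrite expr2 invfM ler_pM2l // lef_pV2 ?posrE //; lra.
lra.
Qed.

Lemma log_gap_double (n : nat) : (0 < n)%N ->
  log_gap n - (log_gap n.*2 + log_gap n.*2.+1) =
  (2 * n%:R * (2 * n%:R + 1))^-1.
Proof.
move=> n_gt0; rewrite /log_gap -doubleS.
have -> : (n.+1.*2)%:R = 2 * (n%:R + 1) :> R.
  by rewrite -mul2n natrM -[n.+1]addn1 natrD.
have -> : (n.*2.+1)%:R = 2 * n%:R + 1 :> R by rewrite -addn1 -mul2n natrD natrM.
have -> : (n.*2)%:R = 2 * n%:R :> R by rewrite -mul2n natrM.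
have -> : n.+1%:R = n%:R + 1 :> R by rewrite -addn1 natrD.
have : 0 < n%:R :> R by rewrite ltr0n.
move: (n%:R) => x x_gt0.
rewrite !ln_div ?posrE; try lra.
rewrite !lnM ?posrE; try lra.
by field; lra.
Qed.

End LogGap.

(** Removing the term [k = 0] from the series at [i] leaves the series at [i %/ 2]. Uniqueness of
    limits then gives one direction, strong induction on [i] the other. *)
Lemma sum_rel_iff_diff_rel (R : realType) (r Rs : nat -> R) :
  r 0%N = 0 -> Rs 0%N = 0 ->
  (forall i : nat, (1 <= i)%N ->
     series (fun k : nat => r (i %/ 2 ^ k)%N) @ \oo --> Rs i) <->
  (forall n : nat, (1 <= n)%N -> r n = Rs n - Rs (n %/ 2)%N).
Proof.
move=> r0 Rs0; pose s i := series (fun k : nat => r (i %/ 2 ^ k)%N).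
(* Index 0 lies outside the hypothesis but is reached by halving 1. *)
have s0 : s 0%N @ \oo --> Rs 0%N.
  rewrite (_ : s 0%N = fun=> Rs 0%N); first exact: cvg_cst.
  by apply/funext => N; rewrite Rs0 /s /series /= big1 // => k _; rewrite div0n.
have s_shift i : (fun N => s i N.+1) = (fun N => r i + s (i %/ 2)%N N).
  apply/funext => N; rewrite /s /series /= big_nat_recl // expn0 divn1.
  by congr (_ + _); apply: eq_bigr => k _; rewrite -divnMA expnS.
split=> [sum_rel n n_gt0 | diff_rel i].
- have s_cvg i : s i @ \oo --> Rs i.
    by case: i => [|i]; [exact: s0 | exact: sum_rel].
  have : s n @ \oo --> r n + Rs (n %/ 2)%N.
    rewrite -cvg_shiftS s_shift; apply: cvgD; [exact: cvg_cst | exact: s_cvg].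
  by move=> /(cvg_unique (@Rhausdorff _) (s_cvg n)) ->; rewrite addrK.
- elim/ltn_ind: i => i IH i_gt0.
  rewrite -/(s i) -cvg_shiftS s_shift -[Rs i](subrK (Rs (i %/ 2)%N)) -diff_rel //.
  apply: cvgD; first exact: cvg_cst.
  have [i2_gt0|] := ltnP 0 (i %/ 2)%N; first by apply: IH => //; rewrite ltn_Pdiv.
  by rewrite leqn0 => /eqP ->.
Qed.

Theorem theorem3 (R : realType) (r Rs : nat -> R)
    (r0 : r 0%N = 0) (Rs0 : Rs 0%N = 0) :
  let sum_rel :=
    forall i : nat, (1 <= i)%N ->
      series (fun k : nat => r (i %/ 2 ^ k)%N) @ \oo --> Rs i in
  let diff_rel :=
    forall n : nat, (1 <= n)%N -> r n = Rs n - Rs (n %/ 2)%N in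
  (sum_rel <-> diff_rel) /\
  (sum_rel ->
    (cvgn (series1 (fun n : nat => `|r n| / n%:R ^+ 2)) <->
     cvgn (series1 (fun i : nat => `|Rs i| / i%:R ^+ 2))) /\
    (cvgn (series1 (fun n : nat => `|r n| / n%:R ^+ 2)) ->
     let lhs := series1 (fun n : nat => r n * (n%:R^-1 - ln (n.+1%:R / n%:R))) in
     let rhs := series1 (fun i : nat => Rs i / (2 * i%:R * (2 * i%:R + 1))) in
     [/\ cvgn lhs, cvgn rhs & limn lhs = limn rhs])).
Proof.
move=> sum_rel diff_rel; have sum_diff : sum_rel <-> diff_rel.
  exact: sum_rel_iff_diff_rel.
split=> // /sum_diff diff1.
(* The relation extends to [n = 0], so all sums may start at 0. *)
have {}diff1 n : r n = Rs n - Rs n./2.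
  by case: n => [|n]; [rewrite r0 Rs0 subrr | rewrite -divn2 diff1].
rewrite !series1E /= ?r0 ?Rs0 ?normr0 ?mul0r //.
have r_iff := cvgn_weighted_iff _ _ _ Rs0 diff1.
split=> // cr; have cRs := r_iff.1 cr.
set a := log_gap R; set b := fun n : nat => (2 * n%:R * (2 * n%:R + 1))^-1 : R.
have c_ra : cvgn (series (fun n => r n * a n)).
  by apply: cvgn_series_weighted cr; exact: normr_log_gap_le.
have c_Ra : cvgn (series (fun n => Rs n * a n)).
  by apply: cvgn_series_weighted cRs; exact: normr_log_gap_le.
have c_Rb : cvgn (series (fun n => Rs n * b n)).
  apply: cvgn_series_weighted cRs => -[|n].
    by rewrite /b mulr0 mul0r expr0n invr0 normr0.
  have : 0 < n.+1%:R :> R by rewrite ltr0n.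
  rewrite /b; move: (n.+1%:R) => x x_gt0.
  have den_gt0 : 0 < 2 * x * (2 * x + 1) by nra.
  rewrite ger0_norm; last by rewrite invr_ge0 ltW.
  by rewrite lef_pV2 ?posrE ?exprn_gt0 //; nra.
split=> //.
have partial_sum N : series (fun n => r n * a n) N.*2 =
    series (fun n => Rs n * a n) N.*2 - series (fun n => Rs n * a n) N
    + series (fun n => Rs n * b n) N.
  have -> : series (fun n => r n * a n) N.*2 =
      series (fun n => Rs n * a n) N.*2 - series (fun n => Rs n./2 * a n) N.*2.
    rewrite /series /= -sumrB; apply: eq_bigr => n _.
    by rewrite diff1 mulrBl.
  rewrite -addrA; congr (_ + _).
  (* Grouping the indices [2m] and [2m+1] gives [Rs m] the coefficient [a (2m) + a (2m+1)], which is
     [a m - b m] for [m > 0]. *)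
  rewrite [X in - X]series_double /series /= -!sumrN -big_split /=.
  apply: eq_bigr => -[|n] _; first by rewrite /= Rs0 !mul0r !addr0.
  by rewrite doubleK uphalf_double /b -log_gap_double // -/a; ring.
(* The block sum is a difference of two partial sums of the convergent series [Rs n * a n], so it
   tends to 0. As the left-hand series converges, its even partial sums determine its limit. *)
have c_even : series (fun n => r n * a n) N.*2 @[N --> \oo] -->
    limn (series (fun n => Rs n * b n)).
  rewrite (funext partial_sum).
  rewrite -[X in _ --> X]add0r -(subrr (limn (series (fun n => Rs n * a n)))).
  exact: cvgD (cvgB (cvg_comp _ _ cvg_double c_Ra) c_Ra) c_Rb.
exact: cvg_unique (@Rhausdorff R) _ _ _ _ (cvg_comp _ _ cvg_double c_ra) c_even.
Qed.
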